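(* Let $\Gamma\cup\{A\}$ be a finite set of formulas of the propositional language $\mathcal L$. Then: (i) $\Gamma\vdash_{\mathbf{KPC}}A$ iff $\Gamma\vDash_{\mathbf{MS}}A$. (ii) $\Gamma\vdash_{\mathbf{EKPC}}A$ iff $\Gamma\vDash_{\mathbf{sCoTS}}A$. (iii) $\Gamma\vdash_{\mathbf{KTPC}}A$ iff $\Gamma\vDash_{\mathbf{CoTS}}A$. (iv) $\Gamma\vdash_{\mathbf{BPC}}A$ iff $\Gamma\vDash_{\mathbf{TS}}A$. (v) $\Gamma\vdash_{\mathbf{EBPC}}A$ iff $\Gamma\vDash_{\mathbf{sS}}A$. (vi) $\Gamma\vdash_{\mathbf{IPC}}A$ iff $\Gamma\vDash_{\mathbf{S}}A$.
   Context: $\mathcal L$: formulas built from atoms, $\top,\bot$ by $\wedge,\vee,\to$. The logics are natural deduction systems; $\Gamma\vdash A$ means there is a derivation of $A$ with all open assumptions in $\Gamma$. $\mathbf{KPC}$ has the rules: from $A$ infer $\top$; from $\bot$ infer $A$; from $A$, $B$ infer $A\wedge B$; from $A\wedge B$ infer $A$, and infer $B$; from $A$ (or from $B$) infer $A\vee B$; $\vee$-elimination (from $A\vee B$, a derivation of $C$ from assumption $A$, and a derivation of $C$ from assumption $B$, infer $C$, discharging these; side assumptions allowed); $\to I$: from a derivation of $B$ whose only open assumption is $A$, infer $A\to B$, discharging $A$; and the formalized rules: from $A\to B$ and $A\to C$ infer $A\to B\wedge C$; from $A\to C$ and $B\to C$ infer $A\vee B\to C$; from $A\to B$ and $B\to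 C$ infer $A\to C$. Further rules: ($E$) from $\top\to\bot$ infer $\bot$; ($T$) from $A\wedge(A\to B)$ infer $B$; ($cur$) from $A$ infer $\top\to A$. $\mathbf{BPC}=\mathbf{KPC}+cur$; $\mathbf{EKPC}=\mathbf{KPC}+E$; $\mathbf{EBPC}=\mathbf{BPC}+E$; $\mathbf{KTPC}=\mathbf{KPC}+T$; $\mathbf{IPC}=\mathbf{BPC}+T$. A locale $X$ is identified with its frame (complete lattice with finite meets distributing over arbitrary joins). A modal space is a pair $(X,J)$ with $X$ a locale and $J:X\to X$ monotone and preserving all joins; $a\rightarrow_Jb=\bigvee\{d: Jd\wedge a\le b\}$. Classes: $\mathbf{MS}$: all modal spaces; $\mathbf{sCoTS}$: $Ja=0$ implies $a=0$; $\mathbf{TS}$: $Ja\le a$ for all $a$; $\mathbf{CoTS}$: $a\le Ja$ for all $a$; $\mathbf{sS}=\mathbf{sCoTS}\cap\mathbf{TS}$; $\mathbf S=\mathbf{TS}\cap\mathbf{CoTS}$. A valuation on $(X,J)$ is a map $V:\mathcal L\to X$ with $V(\top)=1$, $V(\bot)=0$, $V(A\wedge B)=V(A)\wedge V(B)$, $V(A\vee B)=V(A)\vee V(B)$, $V(A\to B)=V(A)\rightarrow_JV(B)$. $\Gamma\vDash_{\mathcal C}A$ means $\bigwedge_{\gamma\in\Gamma}V(\gamma)\le V(A)$ for every $(X,J)\in\mathcal C$ and every valuation $V$ on it. *)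

(* Defs.v *)
From HB Require Import structures.
From mathcomp Require Import all_boot all_order.
From mathcomp Require Import boolp classical_sets cardinality.

Set Implicit Arguments.
Unset Strict Implicit.
Unset Printing Implicit Defensive.

Local Open Scope classical_set_scope.

Inductive form (At : Type) : Type :=
| Atom of At
| Top
| Bot
| And of form At & form At
| Or of form At & form At
| Imp of form At & form At.

Arguments Top {At}.
Arguments Bot {At}.

Declare Scope form_scope.
Delimit Scope form_scope with F.
Bind Scope form_scope with form.
Notation "A ∧ B" := (And A B) (at level 40, left associativity) : form_scope.
Notation "A ∨ B" := (Or A B) (at level 50, left associativity) : form_scope.
Notation "A ⊃ B" := (Imp A B) (at level 55, right associativity) : form_scope.
Notation "⊤" := Top : form_scope.
Notation "⊥" := Bot : form_scope.

(* A logic is KPC together with the set of the further rules it allows. *)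
Inductive extra_rule := rule_E | rule_T | rule_cur.
Definition logic := set extra_rule.

Definition KPC : logic := set0.
Definition BPC : logic := KPC `|` [set rule_cur].
Definition EKPC : logic := KPC `|` [set rule_E].
Definition EBPC : logic := BPC `|` [set rule_E].
Definition KTPC : logic := KPC `|` [set rule_T].
Definition IPC : logic := BPC `|` [set rule_T].

(* Natural deduction in sequent style: [L ;; Γ ⊢ A] says that A has a
   derivation all of whose open assumptions are in Γ.  In [ImpI] the premise is
   derived from A alone; side assumptions are not available. *)
Reserved Notation "L ;; Γ ⊢ A" (at level 70, Γ at level 69, A at level 69).

Inductive derives (At : Type) (L : logic) : set (form At) -> form At -> Prop :=
| Assume (Γ : set (form At)) (A : form At) : Γ A -> L ;; Γ ⊢ A
| TopI Γ A : L ;; Γ ⊢ A -> L ;; Γ ⊢ ⊤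
| BotE Γ A : L ;; Γ ⊢ ⊥ -> L ;; Γ ⊢ A
| AndI Γ A B : L ;; Γ ⊢ A -> L ;; Γ ⊢ B -> L ;; Γ ⊢ (A ∧ B)
| AndE1 Γ A B : L ;; Γ ⊢ (A ∧ B) -> L ;; Γ ⊢ A
| AndE2 Γ A B : L ;; Γ ⊢ (A ∧ B) -> L ;; Γ ⊢ B
| OrI1 Γ A B : L ;; Γ ⊢ A -> L ;; Γ ⊢ (A ∨ B)
| OrI2 Γ A B : L ;; Γ ⊢ B -> L ;; Γ ⊢ (A ∨ B)
| OrE Γ A B C : L ;; Γ ⊢ (A ∨ B) ->
    L ;; Γ `|` [set A] ⊢ C -> L ;; Γ `|` [set B] ⊢ C -> L ;; Γ ⊢ C
| ImpI Γ A B : L ;; [set A] ⊢ B -> L ;; Γ ⊢ (A ⊃ B)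
| ImpAnd Γ A B C :
    L ;; Γ ⊢ (A ⊃ B) -> L ;; Γ ⊢ (A ⊃ C) -> L ;; Γ ⊢ (A ⊃ B ∧ C)
| ImpOr Γ A B C :
    L ;; Γ ⊢ (A ⊃ C) -> L ;; Γ ⊢ (B ⊃ C) -> L ;; Γ ⊢ (A ∨ B ⊃ C)
| ImpTrans Γ A B C :
    L ;; Γ ⊢ (A ⊃ B) -> L ;; Γ ⊢ (B ⊃ C) -> L ;; Γ ⊢ (A ⊃ C)
| RuleE Γ : L rule_E -> L ;; Γ ⊢ (⊤ ⊃ ⊥) -> L ;; Γ ⊢ ⊥
| RuleT Γ A B : L rule_T -> L ;; Γ ⊢ (A ∧ (A ⊃ B)) -> L ;; Γ ⊢ B
| RuleCur Γ A : L rule_cur -> L ;; Γ ⊢ A -> L ;; Γ ⊢ (⊤ ⊃ A)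
where "L ;; Γ ⊢ A" := (derives L Γ A%F).

(* With these defaults [supremum] and [infimum] are also right on the empty
   set; they are the lub and the glb whenever these exist. *)
Notation bigjoin S := (supremum Order.bottom S).
Notation bigmeet S := (infimum Order.top S).

(* MathComp lattices are choice types with a boolean order; under the axioms of
   [boolp] every type is a choice type and every relation is boolean, so this
   does not restrict the class of frames. *)
HB.mixin Record TBLattice_isFrame d T of Order.TBLattice d T := {
  has_supremums : forall S : set T, supremums S !=set0;
  meet_bigjoin : forall (x : T) (S : set T),
    Order.meet x (bigjoin S) = bigjoin [set Order.meet x y | y in S]
}.

#[short(type="frameType")]
HB.structure Definition Frame d :=
  { T of TBLattice_isFrame d T & Order.TBLattice d T }.

Record modal_space := ModalSpace {
  space_disp : Order.disp_t;
  locale :> frameType space_disp;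
  modality : locale -> locale;
  modality_mono : {homo modality : a b / (a <= b)%O};
  modality_bigjoin : forall S : set locale,
    modality (bigjoin S) = bigjoin (modality @` S)
}.

Definition jimp (X : modal_space) (a b : X) : X :=
  bigjoin [set d | (modality d `&` a <= b)%O].

(* Classes of modal spaces are plain predicates: having [set modal_space] would
   force the carriers of frames below the universe of [set], and so exclude
   powersets [set W] as frames. *)
Definition MS (X : modal_space) : Prop := True.
Definition sCoTS (X : modal_space) : Prop :=
  forall a : X, modality a = \bot%O -> a = \bot%O.
Definition TS (X : modal_space) : Prop := forall a : X, (modality a <= a)%O.
Definition CoTS (X : modal_space) : Prop := forall a : X, (a <= modality a)%O.
Definition sS (X : modal_space) : Prop := sCoTS X /\ TS X.
Definition Spaces (X : modal_space) : Prop := TS X /\ CoTS X.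

Record valuation (At : Type) (X : modal_space) (V : form At -> X) : Prop := {
  val_top : V ⊤%F = \top%O;
  val_bot : V ⊥%F = \bot%O;
  val_and : forall A B, V (A ∧ B)%F = (V A `&` V B)%O;
  val_or : forall A B, V (A ∨ B)%F = (V A `|` V B)%O;
  val_imp : forall A B, V (A ⊃ B)%F = jimp (V A) (V B)
}.

Definition entails (At : Type) (C : modal_space -> Prop) (Γ : set (form At))
    (A : form At) : Prop :=
  forall X : modal_space, C X -> forall V : form At -> X, valuation V ->
    (bigmeet (V @` Γ) <= V A)%O.

Notation "C ;; Γ ⊨ A" := (entails C Γ A%F)
  (at level 70, Γ at level 69, A at level 69).

(* Main.v *)
(* Soundness rests on the adjunction x <= jimp a b <-> modality x `&` a <= b.

   Completeness uses, for every logic L at once, a canonical space.  Its points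
   are the prime theories of L, with w related to v when C ⊃ D ∈ w and C ∈ v
   imply D ∈ v.  The frame consists of all sets of points, or with the rule cur
   of those sets that are closed under this relation, and the modality is the
   direct image.  With E the relation is serial, with T it is reflexive.  For a
   theory w, the relation C ⊃ D ∈ w between C and D is again a distributive
   lattice preorder containing derivability, so that a prime theory v related to
   w, with A ∈ v and B ∉ v, can be separated in that preorder if A ⊃ B ∉ w. *)

Require Import Defs.
From HB Require Import structures.
From mathcomp Require Import all_boot all_order.
From mathcomp Require Import boolp classical_sets cardinality.

Set Implicit Arguments.
Unset Strict Implicit.
Unset Printing Implicit Defensive.

Import Order.TTheory.

Local Open Scope classical_set_scope.

(** * Joins and meets in frames *)

Lemma bigjoinE d (T : tbLatticeType d) (S : set T) (m : T) :
  supremums S m -> bigjoin S = m.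
Proof.
move=> Sm; rewrite /supremum; case: ifPn => [/eqP S0|_].
  (* For empty [S] the default bottom is returned; a least upper bound [m] of the empty set lies
     below it. *)
  by apply/le_anti; rewrite le0x /=; apply: (proj2 Sm); rewrite S0.
by case: xgetP => [x _ Sx|/(_ m)//]; exact: (is_subset1_supremums Sx Sm).
Qed.

Section FrameTheory.
Context (d : Order.disp_t) (X : frameType d).
Implicit Types (S : set X) (x : X).

Lemma bigjoin_supremums S : supremums S (bigjoin S).
Proof. by have [m Sm] := has_supremums S; rewrite (bigjoinE Sm). Qed.

Lemma bigjoin_ub S x : S x -> (x <= bigjoin S)%O.
Proof. by have [+ _] := bigjoin_supremums S; apply. Qed.

Lemma bigjoin_lub S x : (forall y, S y -> (y <= x)%O) -> (bigjoin S <= x)%O.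
Proof. by have [_ +] := bigjoin_supremums S; apply. Qed.

Lemma bigmeet_infimums S : infimums S (bigmeet S).
Proof.
have inf_join : infimums S (bigjoin (lbound S)).
  split=> [y Sy|y Sy]; last exact: bigjoin_ub.
  by apply: bigjoin_lub => z; apply.
rewrite /infimum; case: ifPn => [/eqP ->|_].
  by split=> [y//|y _]; exact: lex1.
by case: xgetP => [//|/(_ (bigjoin (lbound S)))].
Qed.

Lemma bigmeet_lb S x : S x -> (bigmeet S <= x)%O.
Proof. by have [+ _] := bigmeet_infimums S; apply. Qed.

Lemma bigmeet_glb S x : (forall y, S y -> (x <= y)%O) -> (x <= bigmeet S)%O.
Proof. by have [_ +] := bigmeet_infimums S; apply. Qed.

(** A binary join is the join of a two-element set, so the infinite distributive law applies. *)
Lemma frame_meetUr (x y z : X) :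
  (x `&` (y `|` z) <= (x `&` y) `|` (x `&` z))%O.
Proof.
have -> : (y `|` z)%O = bigjoin [set y; z].
  apply/esym/bigjoinE; split=> [_ [->|->]|u yzu]; rewrite ?leUl ?leUr//.
  by rewrite leUx !yzu//; [right|left].
rewrite meet_bigjoin; apply: bigjoin_lub => _ [u [->|->] <-].
  exact: leUl.
exact: leUr.
Qed.

End FrameTheory.

(** * The adjunction and soundness *)

Lemma le_jimp (X : modal_space) (x a b : X) :
  (x <= jimp a b)%O = (modality x `&` a <= b)%O.
Proof.
apply/idP/idP => [xab|]; last exact: bigjoin_ub.
(* Since [modality] preserves joins and meets distribute over them, [jimp a b] itself satisfies the
   condition whose solutions it joins. *)
apply: (@le_trans _ _ (modality (jimp a b) `&` a)%O).
  by apply: leI2 => //; exact: modality_mono.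
rewrite modality_bigjoin meetC meet_bigjoin.
by apply: bigjoin_lub => _ [_ [u + <-] <-]; rewrite meetC.
Qed.

(** Quantifying over [x] instead of fixing the meet of [Γ] lets the induction hypotheses be used at
    other elements: the meet of [x] with a disjunct in [OrE], the meet of [modality x] with [V A] in
    [ImpI]. *)
Lemma derives_sound (At : Type) (L : logic) (X : modal_space)
    (V : form At -> X) (Γ : set (form At)) (A : form At) :
  (L rule_E -> sCoTS X) -> (L rule_T -> CoTS X) -> (L rule_cur -> TS X) ->
  valuation V -> L ;; Γ ⊢ A ->
  forall x : X, (forall B, Γ B -> (x <= V B)%O) -> (x <= V A)%O.
Proof.
move=> XE XT Xcur [V1 V0 VI VU Vimp]; elim => {Γ A}.
- by move=> Γ A ΓA x; apply.
- by move=> Γ A _ _ x _; rewrite V1 lex1.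
- move=> Γ A _ IH x /IH; rewrite V0 => /le_trans; apply; exact: le0x.
- by move=> Γ A B _ IHA _ IHB x xΓ; rewrite VI lexI IHA// IHB.
- by move=> Γ A B _ IH x /IH; rewrite VI lexI => /andP[].
- by move=> Γ A B _ IH x /IH; rewrite VI lexI => /andP[].
- by move=> Γ A B _ IH x /IH /le_trans; apply; rewrite VU leUl.
- by move=> Γ A B _ IH x /IH /le_trans; apply; rewrite VU leUr.
- move=> Γ A B C _ IH _ IHA _ IHB x xΓ.
  rewrite -(meet_idPl (IH x xΓ)) VU; apply: le_trans (frame_meetUr _ _ _) _.
  rewrite leUx; apply/andP; split.
    by apply: IHA => D [/xΓ|->]; [exact: leIxl|exact: leIr].
  by apply: IHB => D [/xΓ|->]; [exact: leIxl|exact: leIr].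
- move=> Γ A B _ IH x _; rewrite Vimp le_jimp.
  by apply: IH => _ ->; exact: leIr.
- move=> Γ A B C _ IHB _ IHC x xΓ.
  by rewrite Vimp le_jimp VI lexI -!le_jimp -!Vimp IHB// IHC.
- move=> Γ A B C _ IHA _ IHB x xΓ.
  rewrite Vimp le_jimp VU; apply: le_trans (frame_meetUr _ _ _) _.
  by rewrite leUx -!le_jimp -!Vimp IHA// IHB.
- move=> Γ A B C _ IHAB _ IHBC x xΓ.
  move: (IHAB x xΓ) (IHBC x xΓ); rewrite !Vimp !le_jimp => AB.
  by apply: le_trans; rewrite lexI AB leIl.
- move=> Γ LE _ IH x /IH; rewrite Vimp le_jimp V1 V0 meetx1 lex0 => /eqP.
  by move=> /(XE LE) ->.
- move=> Γ A B LT _ IH x /IH; rewrite VI lexI Vimp le_jimp => /andP[xA].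
  by apply: le_trans; rewrite lexI xA (XT LT).
- move=> Γ A Lcur _ IH x /IH xA; rewrite Vimp le_jimp; apply: leIxl.
  exact: le_trans (Xcur Lcur x) xA.
Qed.

(** * Structural rules and filters *)

Section Derivations.
Context (At : Type) (L : logic).
Implicit Types (A B C D : form At) (Γ Δ : set (form At)).

Lemma weakening Γ Δ A : Γ `<=` Δ -> L ;; Γ ⊢ A -> L ;; Δ ⊢ A.
Proof.
move=> + ΓA; elim: ΓA Δ => {Γ A}.
- by move=> Γ A ΓA Δ ΓΔ; apply: Assume; exact: ΓΔ.
- by move=> Γ A _ IH Δ /IH; exact: TopI.
- by move=> Γ A _ IH Δ /IH; exact: BotE.
- by move=> Γ A B _ IHA _ IHB Δ ΓΔ; apply: AndI; [exact: IHA|exact: IHB].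
- by move=> Γ A B _ IH Δ /IH; exact: AndE1.
- by move=> Γ A B _ IH Δ /IH; exact: AndE2.
- by move=> Γ A B _ IH Δ /IH; exact: OrI1.
- by move=> Γ A B _ IH Δ /IH; exact: OrI2.
- move=> Γ A B C _ IH _ IHA _ IHB Δ ΓΔ.
  by apply: (OrE (IH _ ΓΔ)); [apply: IHA|apply: IHB]; exact: setSU.
- by move=> Γ A B AB _ Δ _; exact: ImpI.
- by move=> Γ A B C _ IHB _ IHC Δ ΓΔ; apply: ImpAnd; [exact: IHB|exact: IHC].
- by move=> Γ A B C _ IHA _ IHB Δ ΓΔ; apply: ImpOr; [exact: IHA|exact: IHB].
- move=> Γ A B C _ IHA _ IHB Δ ΓΔ.
  by apply: ImpTrans; [exact: IHA|exact: IHB].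
- by move=> Γ LE _ IH Δ /IH; exact: RuleE.
- by move=> Γ A B LT _ IH Δ /IH; exact: RuleT.
- by move=> Γ A Lcur _ IH Δ /IH; exact: RuleCur.
Qed.

(** [ImpI] allows no side assumptions, so the cut is made by eliminating [A ∨ A]. *)
Lemma cut Γ A B : L ;; Γ ⊢ A -> L ;; [set A] ⊢ B -> L ;; Γ ⊢ B.
Proof.
move=> ΓA AB; have AB' : L ;; Γ `|` [set A] ⊢ B.
  by apply: weakening AB => C; right.
exact: (OrE (OrI1 A ΓA) AB' AB').
Qed.

Lemma derives_refl A : L ;; [set A] ⊢ A.
Proof. exact: Assume. Qed.

Lemma derives_andl A B : L ;; [set (A ∧ B)%F] ⊢ A.
Proof. exact: AndE1 (derives_refl _). Qed.

Lemma derives_andr A B : L ;; [set (A ∧ B)%F] ⊢ B.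
Proof. exact: AndE2 (derives_refl _). Qed.

Lemma derives_and13 A B C : L ;; [set (A ∧ B ∧ C)%F] ⊢ A ∧ C.
Proof. exact: AndI (AndE1 (derives_andl _ _)) (derives_andr _ _). Qed.

Lemma derives_and23 A B C : L ;; [set (A ∧ B ∧ C)%F] ⊢ B ∧ C.
Proof. exact: AndI (AndE2 (derives_andl _ _)) (derives_andr _ _). Qed.

Lemma derives_and_or A B C : L ;; [set (A ∧ (B ∨ C))%F] ⊢ (A ∧ B) ∨ (A ∧ C).
Proof.
apply: OrE (derives_andr _ _) _ _; [apply: OrI1|apply: OrI2];
  (apply: AndI; last by apply: Assume; right);
  by apply: (@AndE1 _ _ _ _ (B ∨ C)); apply: Assume; left.
Qed.

(* Abstracts what the order of derivability and, for a theory w, the order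
   C ⊃ D ∈ w have in common. *)
Record entailment (le : form At -> form At -> Prop) : Prop := Entailment {
  entailment_derives : forall A B, L ;; [set A] ⊢ B -> le A B;
  entailment_trans : forall A B C, le A B -> le B C -> le A C;
  entailment_and : forall A B C, le A B -> le A C -> le A (B ∧ C)%F;
  entailment_or : forall A B C, le A C -> le B C -> le (A ∨ B)%F C
}.

Record filter (le : form At -> form At -> Prop) (P : set (form At)) : Prop :=
  Filter {
  filter_top : P ⊤%F;
  filter_and : forall A B, P A -> P B -> P (A ∧ B)%F;
  filter_le : forall A B, P A -> le A B -> P B
}.

Record prime (P : set (form At)) : Prop := Prime {
  prime_bot : ~ P ⊥%F;
  prime_or : forall A B, P (A ∨ B)%F -> P A \/ P B
}.

Definition derivable A B := L ;; [set A] ⊢ B.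

Lemma entailment_derivable : entailment derivable.
Proof.
split=> // [A B C|A B C|A B C AC BC]; [exact: cut|exact: AndI|].
by apply: OrE (derives_refl _) _ _;
  [apply: weakening AC|apply: weakening BC] => D; right.
Qed.

Lemma filter_derives Γ : filter derivable [set A | L ;; Γ ⊢ A].
Proof.
split=> /= [|A B|A B]; [|exact: AndI|exact: cut].
(* [TopI] has a premise; the theorem [⊤ ⊃ ⊤] provides one for every [Γ]. *)
exact: TopI (ImpI Γ (derives_refl ⊤)).
Qed.

Lemma entailment_filter (le : form At -> form At -> Prop) P :
  entailment le -> filter le P -> filter derivable P.
Proof.
move=> [led _ _ _] [P1 PI Ple]; split=> // A B PA AB.
by apply: Ple PA _; exact: led.
Qed.

(** * Prime filters by Zorn's lemma *)

Section Extension.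
Context (le : form At -> form At -> Prop) (ent : entailment le).

(** The set is the filter generated by [P] and [C]. *)
Lemma filter_adjoin P C : filter le P ->
  filter le [set D | exists2 A, P A & le (A ∧ C)%F D].
Proof.
case: (ent) => led letr leI _ [P1 PI Ple]; split=> /=.
- by exists ⊤%F => //; apply: led; exact: TopI (derives_refl _).
- move=> D E [A PA ACD] [B PB BCE]; exists (A ∧ B)%F; first exact: PI.
  apply: leI; [apply: letr _ ACD|apply: letr _ BCE]; apply: led.
    exact: derives_and13.
  exact: derives_and23.
- by move=> D E [A PA ACD] DE; exists A => //; exact: letr ACD DE.
Qed.

(** A filter maximal among those that contain [F] and omit [B] is prime: if it had a disjunction but
    neither disjunct, adjoining either would yield [B], and distributivity would put [B] in it. *)
Lemma prime_extension F B : filter le F -> ~ F B ->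
  exists P, [/\ filter le P, prime P, F `<=` P & ~ P B].
Proof.
case: (ent) => led letr leI leU fF nFB.
(* The condition is put on X ∪ F rather than on X because the union of the
   empty chain is not a filter. *)
pose good X := filter le (X `|` F) /\ ~ (X `|` F) B.
have [|X [[fX nXB] maxX]] := @Zorn_bigcup _ good.
  move=> K Kgood Ktot; split; last first.
    move=> [[X KX XB]|//]; have [_] := Kgood _ KX; apply; exact: or_introl.
  (* The filter conditions involve at most two formulas at once; along a chain these lie in a single
     [Y ∪ F], where [Y = F] serves if both come from [F]. *)
  have upd A D : (\bigcup_(X in K) X `|` F) A ->
      (\bigcup_(X in K) X `|` F) D ->
      exists2 Y, (K Y \/ Y = F) & (Y `|` F) A /\ (Y `|` F) D.
    move=> [[X KX XA]|FA] [[Y KY YD]|FD].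
    - have [XY|YX] := Ktot X Y KX KY.
      + by exists Y; [left|split; left => //; exact: XY].
      + by exists X; [left|split; left => //; exact: YX].
    - by exists X; [left|split; [left|right]].
    - by exists Y; [left|split; [right|left]].
    - by exists F; [right|split; left].
  have fY Y : K Y \/ Y = F -> filter le (Y `|` F).
    by move=> [/Kgood[]//|->]; rewrite setUid.
  have subY Y : K Y \/ Y = F -> Y `|` F `<=` \bigcup_(X in K) X `|` F.
    move=> [KY|->]; last by rewrite setUid; exact: subsetUr.
    by apply: setSU; exact: bigcup_sup.
  split.
  - by right; exact: filter_top fF.
  - move=> A D KA KD; have [Y KY [YA YD]] := upd A D KA KD.
    by apply: (subY Y KY); apply: filter_and YA YD; exact: fY.
  - move=> A D KA AD; have [Y KY [YA _]] := upd A A KA KA.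
    by apply: (subY Y KY); apply: filter_le YA AD; exact: fY.
exists (X `|` F); split => //.
set P := X `|` F in fX nXB.
split=> [P0|C D PCD].
  by apply: nXB; apply: filter_le fX _ _ P0 _; apply: led;
    exact: BotE (derives_refl _).
have adj E : ~ P E -> exists2 A, P A & le (A ∧ E)%F B.
  move=> nPE; apply: contrapT => nB.
  (* By maximality the filter [Q] generated by [P] and [E], which properly extends [P], cannot omit
     [B]. *)
  pose Q := [set G | exists2 A, P A & le (A ∧ E)%F G].
  have PQ : P `<=` Q.
    by move=> A PA; exists A => //; apply: led; exact: derives_andl.
  have QF : Q `|` F = Q.
    by apply/setUidPl => A FA; apply: PQ; right.
  apply: (maxX Q); last by split; rewrite QF //; exact: filter_adjoin.
  split=> [A XA|XQ]; first by apply: PQ; left.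
  apply: nPE; left; apply: XQ; exists ⊤%F; first exact: filter_top fX.
  by apply: led; exact: derives_andr.
apply: contrapT => /not_orP[/adj[A PA ACB] /adj[A' PA' ADB]].
apply: nXB; have PAA := filter_and fX (filter_and fX PA PA') PCD.
apply: filter_le fX _ _ PAA _; apply: (letr _ _ _ (led _ _ (derives_and_or _ _ _))).
by apply: leU; [apply: letr ACB|apply: letr ADB]; apply: led;
  [exact: derives_and13|exact: derives_and23].
Qed.

End Extension.
End Derivations.

(** * The frame of closed sets with the direct image *)

Definition is_closed (W : Type) (S : W -> W -> Prop) : pred (set W) :=
  fun D => `[< forall w v, D w -> S w v -> D v >].

(** These are the open sets of the Alexandrov topology of the preorder generated by [S]. *)
Record closed_set (W : Type) (S : W -> W -> Prop) := ClosedSet {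
  closed_set_val : set W;
  closed_setP : is_closed S closed_set_val
}.

Section ClosedSets.
Context (W : Type) (S : W -> W -> Prop).
Local Notation C := (@is_closed W S).

Lemma is_closedP (D : set W) :
  reflect (forall w v, D w -> S w v -> D v) (D \in C).
Proof. exact: asboolP. Qed.

HB.instance Definition _ := [isSub of closed_set S for @closed_set_val W S].
HB.instance Definition _ := [Choice of closed_set S by <:].

Let closedI : meet_closed C.
Proof.
move=> D E /is_closedP cD /is_closedP cE; apply/is_closedP => w v [Dw Ew] wv.
by split; [exact: cD wv|exact: cE wv].
Qed.

Let closedU : join_closed C.
Proof.
move=> D E /is_closedP cD /is_closedP cE; apply/is_closedP => w v [Dw|Ew] wv.
  by left; exact: cD wv.
by right; exact: cE wv.
Qed.

Let closed0 : \bot%O \in C.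
Proof. exact/is_closedP. Qed.

Let closedT : \top%O \in C.
Proof. exact/is_closedP. Qed.

HB.instance Definition _ := Order.SubChoice_isTBSubLattice.Build _ _ _
  set_display (closed_set S) closedI closedU closed0 closedT.

Lemma le_closed_setP (D E : closed_set S) :
  reflect (closed_set_val D `<=` closed_set_val E) (D <= E)%O.
Proof. exact: asboolP. Qed.

Lemma closed_set_succ (D : closed_set S) w v :
  closed_set_val D w -> S w v -> closed_set_val D v.
Proof. by have /is_closedP := closed_setP D; apply. Qed.

Lemma closed_setU_proof (K : set (closed_set S)) :
  \bigcup_(D in K) closed_set_val D \in C.
Proof.
apply/is_closedP => w v [D KD Dw] wv; exists D => //.
exact: closed_set_succ Dw wv.
Qed.

Definition closed_bigU (K : set (closed_set S)) := ClosedSet (closed_setU_proof K).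

Lemma closed_bigU_supremums K : supremums K (closed_bigU K).
Proof.
split=> [D KD|D ubD]; first by apply/le_closed_setP => w Dw; exists D.
by apply/le_closed_setP => w [E KE Ew]; move: w Ew; apply/le_closed_setP/ubD.
Qed.

Lemma closed_set_has_supremums (K : set (closed_set S)) : supremums K !=set0.
Proof. by exists (closed_bigU K); exact: closed_bigU_supremums. Qed.

Lemma closed_set_meet_bigjoin (D : closed_set S) (K : set (closed_set S)) :
  (D `&` bigjoin K)%O = bigjoin [set D `&` E | E in K]%O.
Proof.
rewrite !(bigjoinE (closed_bigU_supremums _)); apply/le_anti/andP; split.
  apply/le_closed_setP => w [Dw [E KE Ew]].
  by exists (D `&` E)%O; [exists E|].
by apply/le_closed_setP => w [_ [E KE <-] [Dw Ew]]; split=> //; exists E.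
Qed.

HB.instance Definition _ := TBLattice_isFrame.Build _ (closed_set S)
  closed_set_has_supremums closed_set_meet_bigjoin.

Context (R : W -> W -> Prop)
  (RS : forall w v u, R w v -> S v u -> S w v /\ R v u).

(** [RS] gives [S w v] and [R v u], so [v] itself lies in [D] and is the witness for [u]. *)
Lemma closed_image_proof (D : closed_set S) :
  [set v | exists2 w, closed_set_val D w & R w v] \in C.
Proof.
apply/is_closedP => v u [w Dw wv] vu; have [Swv Rvu] := RS wv vu.
by exists v => //; exact: closed_set_succ Dw Swv.
Qed.

Definition closed_image (D : closed_set S) := ClosedSet (closed_image_proof D).

Lemma closed_image_mono : {homo closed_image : D E / (D <= E)%O}.
Proof.
by move=> D E /le_closed_setP DE; apply/le_closed_setP => v [w /DE Ew wv]; exists w.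
Qed.

Lemma closed_image_bigjoin K :
  closed_image (bigjoin K) = bigjoin (closed_image @` K).
Proof.
rewrite !(bigjoinE (closed_bigU_supremums _)); apply/le_anti/andP; split.
  apply/le_closed_setP => v [w [D KD Dw] wv].
  by exists (closed_image D); [exists D|exists w].
by apply/le_closed_setP => v [_ [D KD <-] [w Dw wv]]; exists w => //; exists D.
Qed.

Definition relational_space : modal_space :=
  ModalSpace closed_image_mono closed_image_bigjoin.

End ClosedSets.

(** * The canonical space and completeness *)

Section Canonical.
Context (At : Type) (L : logic).
Implicit Types (A B C D : form At).

Definition world :=
  {w : set (form At) | filter (derivable L) w /\ prime w}.

Definition access (w v : world) : Prop :=
  forall C D, sval w (C ⊃ D)%F -> sval v C -> sval v D.

(* Empty without the rule cur, so that the frame below is the full powerset. *)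
Definition persist (w v : world) : Prop := L rule_cur /\ access w v.

Lemma world_derives (w : world) A B :
  sval w A -> L ;; [set A] ⊢ B -> sval w B.
Proof. by case: w => w /= [[_ _ fle] _]; exact: fle. Qed.

Lemma world_derives2 (w : world) A B C :
  sval w A -> sval w B -> L ;; [set (A ∧ B)%F] ⊢ C -> sval w C.
Proof.
move=> wA wB; apply: world_derives; move: wA wB.
by case: w => w /= [[_ fI _] _]; exact: fI.
Qed.

Lemma world_top (w : world) : sval w ⊤%F.
Proof. by case: w => w /= [[]]. Qed.

Lemma world_bot (w : world) : ~ sval w ⊥%F.
Proof. by case: w => w /= [_ []]. Qed.

Lemma world_or (w : world) A B : sval w (A ∨ B)%F -> sval w A \/ sval w B.
Proof. by case: w => w /= [_ [_]]; apply. Qed.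

Lemma world_thm (w : world) A B : L ;; [set A] ⊢ B -> sval w (A ⊃ B)%F.
Proof. by move=> AB; apply: world_derives (world_top w) _; exact: ImpI. Qed.

(** The conditions are the rules [ImpTrans], [ImpAnd] and [ImpOr] read inside [w]; [ImpI] brings in
    derivability. *)
Lemma world_entailment (w : world) :
  entailment L (fun A B => sval w (A ⊃ B)%F).
Proof.
split=> [A B|A B C AB BC|A B C AB AC|A B C AC BC]; first exact: world_thm.
- by apply: world_derives2 AB BC _;
    exact: ImpTrans (derives_andl _ _ _) (derives_andr _ _ _).
- by apply: world_derives2 AB AC _;
    exact: ImpAnd (derives_andl _ _ _) (derives_andr _ _ _).
- by apply: world_derives2 AC BC _;
    exact: ImpOr (derives_andl _ _ _) (derives_andr _ _ _).
Qed.

(** For a filter of the order given by [w], upward closure is exactly accessibility from [w]. The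
    filter to extend is the one generated by [A]. *)
Lemma access_extension (w : world) A B : ~ sval w (A ⊃ B)%F ->
  exists v, [/\ access w v, sval v A & ~ sval v B].
Proof.
move=> nAB; have ent := world_entailment w.
have [|P [fP pP AP nPB]] := prime_extension (F := fun D => sval w (A ⊃ D)%F)
  ent _ nAB.
  split=> [|C D|C D].
  - exact/world_thm/(TopI (derives_refl _ A)).
  - exact: (entailment_and ent).
  - exact: (entailment_trans ent).
exists (exist _ P (conj (entailment_filter ent fP) pP)); split=> //.
  by move=> C D wCD PC; apply: filter_le fP _ _ PC wCD.
exact/AP/world_thm/derives_refl.
Qed.

(** In [w], cur turns [A] into [⊤ ⊃ A], and [⊤] lies in [v]. Hence truth sets are closed under
    [persist]. *)
Lemma access_cur (w v : world) A :
  L rule_cur -> access w v -> sval w A -> sval v A.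
Proof.
move=> Lcur wv wA; apply: wv (world_top v).
by apply: world_derives wA _; apply: RuleCur (derives_refl _ _).
Qed.

(** [persist v u] already supplies cur, under which [persist] and [access] coincide. *)
Lemma persist_access (w v u : world) :
  access w v -> persist v u -> persist w v /\ access v u.
Proof. by move=> wv [Lcur vu]. Qed.

Definition canonical_space : modal_space := relational_space persist_access.

Lemma truth_set_proof A : [set w : world | sval w A] \in is_closed persist.
Proof. by apply/is_closedP => w v wA [Lcur /access_cur]; apply. Qed.

Definition truth_set A : canonical_space := ClosedSet (truth_set_proof A).

Lemma truth_set_valuation : valuation truth_set.
Proof.
split=> [||A B|A B|A B]; apply/le_anti/andP; split; apply/le_closed_setP.
- by [].
- by move=> w _; exact: world_top.
- by move=> w /world_bot.
- by [].
- by move=> w wAB; split; apply: world_derives wAB _;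
    [exact: derives_andl|exact: derives_andr].
- by move=> w [wA wB]; exact: (world_derives2 wA wB (derives_refl _ _)).
- by move=> w /world_or.
- by move=> w [wA|wB]; [apply: world_derives wA _|apply: world_derives wB _];
    [apply: OrI1|apply: OrI2]; exact: derives_refl.
- suff /le_closed_setP :
      (truth_set (A ⊃ B) <= jimp (truth_set A) (truth_set B))%O by [].
  rewrite le_jimp; apply/le_closed_setP.
  by move=> v [[w wAB wv] vA]; exact: wv wAB vA.
(* A successor [v] with [A] but not [B] contradicts the counit of the adjunction, which is
   reflexivity at [jimp] transposed. *)
- move=> w wj; apply: contrapT => /access_extension[v [wv vA nvB]].
  have := lexx (jimp (truth_set A) (truth_set B)).
  by rewrite le_jimp => /le_closed_setP/(_ v) h; apply/nvB/h; split=> //; exists w.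
Qed.

Lemma canonical_sCoTS : L rule_E -> sCoTS canonical_space.
Proof.
move=> LE D D0; apply/le_anti; rewrite le0x andbT; apply/le_closed_setP => w Dw.
(* Rule E keeps [⊤ ⊃ ⊥] out of [w], so [w] has a successor, which lies in the image of [D]. *)
have [|v [wv _ _]] := @access_extension w ⊤%F ⊥%F.
  move=> /world_derives h; apply: (@world_bot w); apply: h.
  exact: RuleE (derives_refl _ _).
have : closed_set_val (modality D) v by exists w.
by rewrite D0.
Qed.

Lemma canonical_CoTS : L rule_T -> CoTS canonical_space.
Proof.
move=> LT D; apply/le_closed_setP => w Dw; exists w => // A B wAB wA.
by apply: world_derives2 wA wAB _; apply: RuleT (derives_refl _ _).
Qed.

Lemma canonical_TS : L rule_cur -> TS canonical_space.
Proof.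
move=> Lcur D; apply/le_closed_setP => v [w Dw wv].
exact: closed_set_succ Dw (conj Lcur wv).
Qed.

(** A prime theory that contains the consequences of [Γ] and omits [A] is a world where the
    entailment fails. *)
Lemma completeness (K : modal_space -> Prop) (Γ : set (form At)) A :
  K canonical_space -> K ;; Γ ⊨ A -> L ;; Γ ⊢ A.
Proof.
move=> KC ΓA; apply: contrapT => nA.
have [P [fP pP ΓP nPA]] :=
  prime_extension (entailment_derivable At L) (filter_derives L Γ) nA.
pose w : world := exist _ P (conj fP pP).
have Γw : (bigmeet (truth_set @` Γ) <= truth_set A)%O.
  exact: ΓA KC _ truth_set_valuation.
move/le_closed_setP : Γw => /(_ w) Aw; apply: nPA; apply: Aw.
(* The intersection of the truth sets is closed, hence below their meet in the frame, and [w] lies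
   in it. *)
have closed_cap : \bigcap_(B in Γ) closed_set_val (truth_set B) \in is_closed persist.
  apply/is_closedP => u v uΓ uv B ΓB.
  exact: (closed_set_succ (D := truth_set B) (uΓ B ΓB) uv).
have : (ClosedSet closed_cap <= bigmeet (truth_set @` Γ))%O.
  apply: bigmeet_glb => _ [B ΓB <-]; apply/le_closed_setP => u uΓ.
  exact: uΓ B ΓB.
move/le_closed_setP; apply => B ΓB; apply: ΓP; exact: Assume.
Qed.

End Canonical.

(** * The six equivalences *)

Lemma derives_entails (At : Type) (L : logic) (K : modal_space -> Prop)
    (Γ : set (form At)) (A : form At) :
  (forall X, K X -> [/\ L rule_E -> sCoTS X, L rule_T -> CoTS X &
                        L rule_cur -> TS X]) ->
  K (canonical_space At L) -> L ;; Γ ⊢ A <-> K ;; Γ ⊨ A.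
Proof.
move=> KL KC; split; last exact: completeness.
move=> ΓA X KX V valV; have [XE XT Xcur] := KL X KX.
apply: derives_sound XE XT Xcur valV ΓA _ _ => B ΓB.
by apply: bigmeet_lb; exists B.
Qed.

Theorem theorem5p12 (At : Type) (Γ : set (form At)) (A : form At)
    (fin : finite_set (Γ `|` [set A])) :
  (KPC ;; Γ ⊢ A <-> MS ;; Γ ⊨ A) /\
  (EKPC ;; Γ ⊢ A <-> sCoTS ;; Γ ⊨ A) /\
  (KTPC ;; Γ ⊢ A <-> CoTS ;; Γ ⊨ A) /\
  (BPC ;; Γ ⊢ A <-> TS ;; Γ ⊨ A) /\
  (EBPC ;; Γ ⊢ A <-> sS ;; Γ ⊨ A) /\
  (IPC ;; Γ ⊢ A <-> Spaces ;; Γ ⊨ A).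
Proof.
have cE := @canonical_sCoTS At; have cT := @canonical_CoTS At.
have cC := @canonical_TS At.
split; last (split; last (split; last (split; last split)));
  (* Each equivalence leaves two goals: the class validates the rules of the logic, the absent rules
     giving a false premise, and the canonical space belongs to the class. *)
  (apply: derives_entails => [X XK|]).
- by split.
- by [].
- by split=> // -[].
- by apply: cE; right.
- by split=> // -[].
- by apply: cT; right.
- by split=> // -[].
- by apply: cC; right.
- by have [XE XT] := XK; split=> // -[[]|].
- by split; [apply: cE; right|apply: cC; left; right].
- by have [XC XT] := XK; split=> // -[[]|].
- by split; [apply: cC; left; right|apply: cT; right].
Qed.
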